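(* Let $P_v(n)$ be defined by $\sum_{n=0}^{\infty}P_v(n)q^n=v(q)$, where $v(q)=\sum_{n=0}^{\infty}\dfrac{q^{(n+1)^2}(-q;q^2)_n}{(q;q^2)_{n+1}}$, and let $A_4(n)$ denote the number of $4$-regular partitions of $n$. Then for every integer $n\ge 0$, $$P_v(2n+1)=\sum_{k=0}^{\infty}A_4\big(n-k(k+1)\big)=A_4(n)+A_4(n-2)+A_4(n-6)+A_4(n-12)+\cdots.$$
   Context: Notation: $(b;q)_n=\prod_{k=0}^{n-1}(1-bq^k)$ and $\ell_k=\prod_{m\ge1}(1-q^{km})$. A $4$-regular partition is one with no part divisible by $4$; the generating function is $\sum_{n\ge0}A_4(n)q^n=\ell_4/\ell_1$. Convention: $A_4(m)=0$ for $m<0$. *)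

(* Defs.v *)
From mathcomp Require Import all_boot all_order all_algebra.

Set Implicit Arguments.
Unset Strict Implicit.
Unset Printing Implicit Defensive.

Import Order.TTheory GRing.Theory Num.Theory.
Local Open Scope ring_scope.

(* An infinite sum of integers, in the discrete topology: the partial sums are
   eventually equal to [s]. *)
Definition sums_to (a : nat -> int) (s : int) : Prop :=
  exists N0 : nat, forall N : nat, (N0 <= N)%N -> \sum_(k < N) a k = s.

Lemma sums_to_unique (a : nat -> int) (s t : int) :
  sums_to a s -> sums_to a t -> s = t.
Proof.
move=> [M HM] [N HN].
by rewrite -(HM (maxn M N) (leq_maxl _ _)) (HN _ (leq_maxr _ _)).
Qed.

(* Formal power series in q over the integers, given by their coefficients. *)
Definition fps := nat -> int.

Definition fps_of_poly (p : {poly int}) : fps := fun n => p`_n.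

Definition fps_mul (a b : fps) : fps :=
  fun n => \sum_(i < n.+1) a i * b (n - i)%N.

(* The first [n] coefficients of 1/a, for a series with [a 0 = 1]. *)
Fixpoint fps_inv_seq (a : fps) (n : nat) : seq int :=
  if n is m.+1 then
    let s := fps_inv_seq a m in
    rcons s ((m == 0)%N%:R - \sum_(i < m) a (m - i)%N * s`_i)
  else [::].

Definition fps_inv (a : fps) : fps := fun n => (fps_inv_seq a n.+1)`_n.

Lemma size_fps_inv_seq (a : fps) (n : nat) : size (fps_inv_seq a n) = n.
Proof. by elim: n => //= n IHn; rewrite size_rcons IHn. Qed.

Lemma nth_fps_inv_seq (a : fps) (n i : nat) :
  (i < n)%N -> (fps_inv_seq a n)`_i = fps_inv a i.
Proof.
elim: n => // n IHn; rewrite ltnS leq_eqVlt => /predU1P[-> //|lt_in].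
by rewrite /= nth_rcons size_fps_inv_seq lt_in IHn.
Qed.

Lemma fps_mulV (a : fps) (n : nat) :
  a 0%N = 1 -> fps_mul a (fps_inv a) n = (n == 0)%N%:R.
Proof.
move=> a0; rewrite /fps_mul big_ord_recl subn0 a0 mul1r.
rewrite {1}/fps_inv /= nth_rcons size_fps_inv_seq ltnn eqxx -addrA.
rewrite (_ : - _ + _ = 0) ?addr0 //; apply/eqP; rewrite addrC subr_eq0.
rewrite [eqbRHS](reindex_inj rev_ord_inj) /=; apply/eqP/eq_bigr => i _.
rewrite nth_fps_inv_seq; last by rewrite -subSn // subSS leq_subr.
by rewrite subKn.
Qed.

(* (b; q)_n *)
Definition qpoch (R : comNzRingType) (b q : R) (n : nat) : R :=
  \prod_(k < n) (1 - b * q ^+ k).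

(* The [n]-th summand of v(q); the indeterminate q is ['X]. *)
Definition v_term (n : nat) : fps :=
  fps_mul (fps_of_poly ('X^((n + 1) ^ 2)%N * qpoch (- 'X) 'X^2 n))
          (fps_inv (fps_of_poly (qpoch 'X 'X^2 (n + 1)%N))).

Lemma v_term_denom0 (n : nat) : fps_of_poly (qpoch 'X 'X^2 (n + 1)%N) 0%N = 1.
Proof.
rewrite /fps_of_poly -horner_coef0 /qpoch horner_prod big1 // => i _.
by rewrite hornerD hornerC hornerN hornerM hornerX mul0r subr0.
Qed.

Lemma v_term_small (n m : nat) : (m < (n + 1) ^ 2)%N -> v_term n m = 0.
Proof.
move=> lt_m; rewrite /v_term /fps_mul big1 // => i _.
by rewrite /fps_of_poly coefXnM (leq_ltn_trans _ lt_m) ?mul0r // -ltnS.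
Qed.

(* [v] is the power series v(q), i.e. the sum of the [v_term n], coefficient by
   coefficient. *)
Definition is_v (v : fps) : Prop :=
  forall m : nat, sums_to (fun n => v_term n m) (v m).

Lemma is_v_exists : exists v : fps, is_v v.
Proof.
exists (fun m => \sum_(n < m) v_term n m) => m; exists m => N le_mN.
rewrite -(subnKC le_mN) big_split_ord /= [X in _ + X]big1 ?addr0 // => i _.
apply: v_term_small; rewrite (leq_trans (leq_addr i m.+1)) // addSn -addn1.
by rewrite -mulnn leq_pmulr // addn1.
Qed.

Definition is_partition (n : nat) (s : seq nat) : bool :=
  [&& sorted geq s, 0%N \notin s & sumn s == n].

Definition is_regular_partition (l n : nat) (s : seq nat) : bool :=
  is_partition n s && all (fun x => ~~ (l %| x)%N) s.

Lemma partition_bound (n : nat) (s : seq nat) :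
  is_partition n s -> (size s <= n)%N && all (fun x => x < n.+1)%N s.
Proof.
case/and3P=> _ s0 /eqP <-; elim: s s0 => //= x s IHs.
rewrite inE negb_or eq_sym -lt0n => /andP[x0 /IHs /andP[le_s all_s]].
apply/and3P; split; first by rewrite -add1n leq_add.
  by rewrite ltnS leq_addr.
by apply: sub_all all_s => y; rewrite !ltnS => /leq_trans-> //; rewrite leq_addl.
Qed.

(* By [partition_bound], every partition of [n] is a sequence of at most [n]
   parts in ['I_n.+1]. *)
Definition num_regular (l n : nat) : nat :=
  #|[set s : n.-bseq 'I_n.+1 | is_regular_partition l n (map val s)]|.

Definition A4 (m : int) : nat :=
  if m is Posz n then num_regular 4 n else 0%N.

(* Main.v *)
Require Import Defs.
From mathcomp Require Import all_boot all_order all_algebra.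
From mathcomp Require Import zify ring.

Set Implicit Arguments.
Unset Strict Implicit.
Unset Printing Implicit Defensive.

Import Order.TTheory GRing.Theory Num.Theory.
Local Open Scope ring_scope.

(** Write p = q^2, U_i = 1/(p; p)_i, W = (q; q^2)_oo (-q; q^2)_oo = (p; p^2)_oo
    and psi = sum over k >= 0 of p^(k(k+1)).  Since W is even in q, the odd part
    of v can be read off from the odd part of W v.

    The n-th term of W v is q^((n+1)^2) (-q; q^2)_n (-q; q^2)_oo
    (q^(2n+3); q^2)_oo.  The first two products combine into a half-infinite
    theta product with expansion sum_i q^((n-i)^2) U_i ([truncated_theta]), and
    Euler's identity ([euler_qexp]) expands the third one, whence
      W v(q) = sum over n, i, l >= 0 of
               (-1)^l U_i U_l q^((n+l+1)^2 + (n-i)^2).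
    In this sum the parity of the exponent is that of i + l + 1, so the odd part
    keeps exactly the terms with i and l of the same parity, and is symmetric
    under exchange of i and l.  Summed over n, the powers of q attached to
    (i, l) and to (l, i) together make up a sum over all n in Z, because
    n -> -1-n exchanges the two families.  Translating n shows that this full
    sum depends on i + l only ([sym_lattice_sum_invariant]); for i + l = 2m its
    value is 2 q^(2m(m+1)+1) psi.  What remains on each antidiagonal is the alternating
    sum of (-1)^l U_l U_(2m-l), which Gauss evaluated as 1/(p^2; p^2)_m
    ([gauss_alternating]), and a second use of Euler's identity gives
    sum_m q^(2m(m+1)) / (p^2; p^2)_m = (-p^2; p^2)_oo.  Thus
      W (v(q) - v(-q)) = 2 q psi (-p^2; p^2)_oo       ([mock_odd_part]),
    while the generating function A of the 4-regular partitions satisfies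
    A(p) W = (-p^2; p^2)_oo ([regular4_gf]).  Cancelling W leaves
    v(q) - v(-q) = 2 q psi A(q^2), whose coefficient at q^(2n+1) is twice the claim.

    No limits are taken: the identities are proved in an arbitrary commutative
    ring for an element q with q^M = 0, where all the infinite sums and products
    become finite, and where 1 - q^k is inverted by a finite geometric sum.  The
    class of q in Z[q]/(q^M) then recovers the coefficients below M
    ([fps_eval_inj]). *)

(** * q-products of a nilpotent base *)

Lemma expr_nil (R : comNzRingType) (y : R) (M n : nat) :
  y ^+ M = 0 -> (M <= n)%N -> y ^+ n = 0.
Proof. by move=> yM le_Mn; rewrite -(subnK le_Mn) exprD yM mulr0. Qed.

Lemma exprX_nil (R : comNzRingType) (y : R) (M k : nat) :
  y ^+ M = 0 -> (0 < k)%N -> (y ^+ k) ^+ M = 0.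
Proof.
by move=> yM k_gt0; rewrite -exprM mulnC exprM yM expr0n eqn0Ngt k_gt0.
Qed.

(** The inverse of 1 - y when y^M = 0. *)
Definition geom (R : comNzRingType) (M : nat) (y : R) : R :=
  \sum_(j < M) y ^+ j.

Lemma geomP (R : comNzRingType) (M : nat) (y : R) :
  y ^+ M = 0 -> (1 - y) * geom M y = 1.
Proof. by move=> yM; rewrite -opprB mulNr -subrX1 yM sub0r opprK. Qed.

Lemma lreg_1sub_nil (R : comNzRingType) (M : nat) (y : R) :
  y ^+ M = 0 -> GRing.lreg (1 - y).
Proof.
move=> yM a b eq_ab; rewrite -[a]mul1r -[b]mul1r -(geomP yM).
by rewrite ![_ * geom _ _]mulrC -!mulrA eq_ab.
Qed.

Lemma qpoch0 (R : comNzRingType) (b q : R) : qpoch b q 0 = 1.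
Proof. exact: big_ord0. Qed.

Lemma qpochS (R : comNzRingType) (b q : R) (n : nat) :
  qpoch b q n.+1 = qpoch b q n * (1 - b * q ^+ n).
Proof. exact: big_ord_recr. Qed.

Lemma qpochD (R : comNzRingType) (b q : R) (m n : nat) :
  qpoch b q (m + n) = qpoch b q m * qpoch (b * q ^+ m) q n.
Proof.
elim: n => [|n IHn]; first by rewrite addn0 qpoch0 mulr1.
by rewrite addnS !qpochS IHn exprD !mulrA.
Qed.

(** Products with at least M factors all represent (b; q)_oo: the factors
    1 - b q^k with k >= M are equal to 1. *)
Lemma qpoch_stable (R : comNzRingType) (b q : R) (M m n : nat) :
  q ^+ M = 0 -> (M <= m)%N -> (M <= n)%N -> qpoch b q m = qpoch b q n.
Proof.
move=> qM; have stab k : (M <= k)%N -> qpoch b q k = qpoch b q M.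
  move=> le_Mk; rewrite -(subnKC le_Mk) qpochD qM mulr0.
  by rewrite [qpoch 0 _ _]big1 ?mulr1 // => i _; rewrite mul0r subr0.
by move=> /stab-> /stab->.
Qed.

(** Used to cancel infinite products such as W; every factor is 1 minus a
    nilpotent. *)
Lemma lreg_qpoch (R : comNzRingType) (b q : R) (M n : nat) :
  b ^+ M = 0 -> GRing.lreg (qpoch b q n).
Proof.
move=> bM; elim: n => [|n IHn]; first by rewrite qpoch0 => x y; rewrite !mul1r.
rewrite qpochS; apply: lregM => //; apply: (@lreg_1sub_nil _ M).
by rewrite exprMn bM mul0r.
Qed.

(** This is 1/(p; p)_n when p^M = 0. *)
Definition qfact_inv (R : comNzRingType) (M : nat) (p : R) (n : nat) : R :=
  \prod_(k < n) geom M (p ^+ k.+1).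

Lemma qfact_inv0 (R : comNzRingType) (M : nat) (p : R) : qfact_inv M p 0 = 1.
Proof. exact: big_ord0. Qed.

Lemma qfact_invS (R : comNzRingType) (M : nat) (p : R) (n : nat) :
  p ^+ M = 0 -> (1 - p ^+ n.+1) * qfact_inv M p n.+1 = qfact_inv M p n.
Proof.
move=> pM; rewrite /qfact_inv big_ord_recr /= mulrCA geomP ?mulr1 //.
exact: exprX_nil.
Qed.

(** Euler: the sum f(z) of z^l p^(l(l-1)/2) / (p; p)_l is (-z; p)_oo.  The
    recurrence f(z) = (1 + z) f(zp), obtained by splitting off 1 - p^l, is
    iterated until zp^K vanishes, and f(0) = 1. *)
Lemma euler_qexp (R : comNzRingType) (M K L : nat) (p z : R) :
  p ^+ M = 0 -> (M <= K)%N -> (M < L)%N ->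
  \sum_(l < L) z ^+ l * p ^+ 'C(l, 2) * qfact_inv M p l = qpoch (- z) p K.
Proof.
move=> pM le_MK; case: L => // L lt_ML.
pose f x := \sum_(l < L.+1) x ^+ l * p ^+ 'C(l, 2) * qfact_inv M p l.
have f0 : f 0 = 1.
  rewrite /f big_ord_recl expr0 qfact_inv0 !mulr1 big1 ?addr0 // => i _.
  by rewrite expr0n !mul0r.
have f_step x : f x = (1 + x) * f (x * p).
  (* the last term of z f(zp) vanishes: its power of p is at least L >= M *)
  rewrite mulrDl mul1r [X in _ = _ + X]mulr_sumr big_ord_recr /=.
  rewrite (_ : x * (_ * _ * _) = 0) ?addr0; last first.
    rewrite exprMn -!mulrA [p ^+ L * _]mulrA -exprD.
    rewrite (expr_nil (n := L + _) pM) ?mul0r ?mulr0 //.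
    exact: leq_trans (leq_addr _ _).
  apply/eqP; rewrite -subr_eq0 opprD addrA subr_eq0 -sumrB; apply/eqP.
  rewrite big_ord_recl /= !expr0 subrr add0r; apply: eq_bigr => i _.
  rewrite -(qfact_invS i pM) binS bin1 !exprMn exprD !exprS; ring.
have f_iter k x : f x = qpoch (- x) p k * f (x * p ^+ k).
  elim: k => [|k IHk]; first by rewrite qpoch0 mul1r mulr1.
  rewrite IHk f_step mulrA qpochS mulNr opprK; congr (_ * f _).
  by rewrite exprSr mulrA.
by rewrite -/(f z) (f_iter K) (expr_nil pM le_MK) mulr0 f0 mulr1.
Qed.

(** * A half-infinite theta product *)

(** The square of m - n: with truncated subtraction at most one of the two
    summands is nonzero. *)
Definition sqdist (m n : nat) : nat := ((m - n) ^ 2 + (n - m) ^ 2)%N.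

Lemma bin2_double (l : nat) : (2 * 'C(l, 2) + l = l ^ 2)%N.
Proof. by elim: l => // l IHl; rewrite binS bin1; nia. Qed.

Lemma sqdistS (n i : nat) :
  (2 * n + 1 + sqdist n i = sqdist n.+1 i + 2 * i)%N.
Proof. by rewrite /sqdist; case: (leqP i n) => ?; nia. Qed.

Lemma sqdistSS (n i : nat) : sqdist n.+1 i.+1 = sqdist n i.
Proof. by rewrite /sqdist !subSS. Qed.

(** With (-q; q^2)_n (-q; q^2)_oo = q^(n^2) (-q^(1-2n); q^2)_oo this is Euler's
    identity at z = q^(1-2n).  Induction on n avoids the negative powers of q:
    multiplication by 1 + q^(2n+1) turns the n-th sum into the next one, since
    q^(2n+1) q^((n-i)^2) = q^((n+1-i)^2) p^i.  The terms left out have i > 2M,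
    hence i - n >= M. *)
Lemma truncated_theta (R : comNzRingType) (M L n : nat) (q : R) :
  q ^+ M = 0 -> (2 * M + 1 < L)%N -> (n <= M)%N ->
  qpoch (- q) (q ^+ 2) n * qpoch (- q) (q ^+ 2) M =
  \sum_(i < L) q ^+ sqdist n i * qfact_inv M (q ^+ 2) i.
Proof.
move=> qM lt_ML; have q2M : (q ^+ 2) ^+ M = 0 by exact: exprX_nil.
elim: n => [|n IHn] le_nM.
  rewrite qpoch0 mul1r -(@euler_qexp _ M _ L) //; last by lia.
  apply: eq_bigr => i _; rewrite -exprM -exprD; congr (_ ^+ _ * _).
  by rewrite /sqdist sub0n subn0 addnC bin2_double.
rewrite qpochS mulrAC (IHn (ltnW le_nM)) mulNr opprK mulrDr mulr1 -exprM -exprS.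
case: L lt_ML {IHn} => // L lt_ML.
rewrite {1}big_ord_recr /= (expr_nil (n := sqdist n L) qM) ?mul0r ?addr0;
  last by rewrite /sqdist; nia.
have shift i : q ^+ sqdist n i * q ^+ (1 + 2 * n) =
    q ^+ sqdist n.+1 i * (q ^+ 2) ^+ i.
  by rewrite -exprM -!exprD [(1 + _)%N]addnC addnC sqdistS.
rewrite mulr_suml [X in _ + X]big_ord_recl [RHS]big_ord_recl /= addrCA.
rewrite mulrAC shift mulr1; congr (_ + _).
rewrite -big_split /=; apply: eq_bigr => i _.
by rewrite mulrAC shift sqdistSS -(qfact_invS i q2M); ring.
Qed.

(** * Gauss's alternating sum *)
Definition alt_sum (R : comNzRingType) (M : nat) (p : R) (m : nat) :=
  \sum_(r < m.+1) (-1) ^+ r * (qfact_inv M p r * qfact_inv M p (m - r)).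

Lemma alt_sum_shift (R : comNzRingType) (M m : nat) (p : R) :
  p ^+ M = 0 ->
  \sum_(r < m.+2)
    (1 - p ^+ r) * ((-1) ^+ r * (qfact_inv M p r * qfact_inv M p (m.+1 - r))) =
  - alt_sum M p m.
Proof.
move=> pM; rewrite big_ord_recl expr0 subrr mul0r add0r -sumrN.
apply: eq_bigr => i _; rewrite lift0 subSS -(qfact_invS i pM) !exprS; ring.
Qed.

(** Split 1 - p^(m+2) as (1 - p^r) + p^r (1 - p^(m+2-r)) and absorb each
    difference into the neighbouring inverse q-factorial: the contributions of
    index m + 1 cancel, and the one of index m survives. *)
Lemma alt_sumSS (R : comNzRingType) (M m : nat) (p : R) :
  p ^+ M = 0 -> (1 - p ^+ m.+2) * alt_sum M p m.+2 = alt_sum M p m.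
Proof.
move=> pM.
have split_r r : (r <= m.+2)%N ->
  1 - p ^+ m.+2 = (1 - p ^+ r) + p ^+ r * (1 - p ^+ (m.+2 - r)).
  by move=> le_r; rewrite mulrBr mulr1 -exprD subnKC // addrA subrK.
rewrite mulr_sumr.
under eq_bigr => r _ do rewrite (split_r r (leq_ord r)) mulrDl.
rewrite big_split /= alt_sum_shift // big_ord_recr /= subnn expr0 subrr.
rewrite mulr0 mul0r addr0 -[RHS](addKr (alt_sum M p m.+1)); congr (_ + _).
rewrite -[X in _ = _ + X]opprK -alt_sum_shift // /alt_sum -sumrB.
apply: eq_bigr => r _.
by rewrite subSn ?leq_ord // -(qfact_invS (m.+1 - r) pM); ring.
Qed.

(** The coefficient of z^(2m) in 1 / ((z; p)_oo (-z; p)_oo) = 1/(z^2; p^2)_oo,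
    obtained from the two-step recurrence. *)
Lemma gauss_alternating (R : comNzRingType) (M m : nat) (p : R) :
  p ^+ M = 0 -> alt_sum M p (2 * m) = qfact_inv M (p ^+ 2) m.
Proof.
move=> pM; elim: m => [|m IHm].
  by rewrite /alt_sum big_ord1 !qfact_inv0 expr0 !mulr1.
have p2M : (p ^+ 2) ^+ M = 0 by exact: exprX_nil.
apply: (@lreg_1sub_nil _ M ((p ^+ 2) ^+ m.+1)); first exact: exprX_nil.
rewrite qfact_invS // -IHm -exprM.
by rewrite (_ : 2 * m.+1 = (2 * m).+2)%N ?alt_sumSS //; lia.
Qed.

(** * The odd part of the mock theta function *)

(** Here t is the n-th term of v, given by its defining equation, and
    (q; q^2)_oo / (q; q^2)_(n+1) = (q^(2n+3); q^2)_oo is expanded by Euler's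
    identity at z = -q^(2n+3).  The exponents combine by
    (n+1)^2 + l^2 + 2l(n+1) = (n+l+1)^2. *)
Lemma mock_term_expansion (R : comNzRingType) (M L n : nat) (q t : R) :
  q ^+ M = 0 -> (2 * M + 1 < L)%N -> (n < M)%N ->
  qpoch q (q ^+ 2) n.+1 * t = q ^+ (n.+1 ^ 2) * qpoch (- q) (q ^+ 2) n ->
  qpoch q (q ^+ 2) (2 * M) * qpoch (- q) (q ^+ 2) M * t =
  \sum_(i < L) \sum_(l < L)
    (-1) ^+ l * (qfact_inv M (q ^+ 2) i * qfact_inv M (q ^+ 2) l) *
    q ^+ ((n + l).+1 ^ 2 + sqdist n i).
Proof.
move=> qM lt_ML lt_nM def_t.
have q2M : (q ^+ 2) ^+ M = 0 by exact: exprX_nil.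
have -> : (2 * M = n.+1 + (2 * M - n.+1))%N by lia.
rewrite qpochD; set tail := qpoch (q * _) _ _.
transitivity ((qpoch (- q) (q ^+ 2) n * qpoch (- q) (q ^+ 2) M) *
              (q ^+ (n.+1 ^ 2) * tail)).
  transitivity ((qpoch q (q ^+ 2) n.+1 * t) * (tail * qpoch (- q) (q ^+ 2) M)).
    by ring.
  by rewrite def_t; ring.
rewrite (truncated_theta qM lt_ML (ltnW lt_nM)) mulr_suml.
apply: eq_bigr => i _.
have -> : tail = \sum_(l < L) (-1) ^+ l * q ^+ (l ^ 2 + 2 * l * n.+1) *
                              qfact_inv M (q ^+ 2) l.
  rewrite /tail -[X in qpoch X]opprK -(@euler_qexp _ M _ L) //; try lia.
  apply: eq_bigr => l _; congr (_ * _).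
  rewrite [X in X * _]exprNn -mulrA; congr (_ * _).
  rewrite -[in (q * _)]exprM -exprS -!exprM -exprD; congr (_ ^+ _).
  by rewrite -(bin2_double l); lia.
rewrite mulrA mulr_sumr; apply: eq_bigr => l _.
have -> : ((n + l).+1 ^ 2 = n.+1 ^ 2 + (l ^ 2 + 2 * l * n.+1))%N by nia.
by rewrite !exprD; ring.
Qed.

Definition lattice_sum (R : comNzRingType) (M : nat) (q : R) (i l : nat) : R :=
  \sum_(n < M) q ^+ ((n + l).+1 ^ 2 + sqdist n i).

(** The exponent a^2 + b^2 with a = n + l + 1 and b = i - n is at least
    a + b > i + l. *)
Lemma lattice_sum_large (R : comNzRingType) (M i l : nat) (q : R) :
  q ^+ M = 0 -> (M <= i + l)%N -> lattice_sum M q i l = 0.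
Proof.
move=> qM le_M; rewrite /lattice_sum big1 // => n _; apply: (expr_nil qM).
by rewrite /sqdist; case: (leqP i n) => ?; nia.
Qed.

(** The exponent (n+l+1)^2 + (n-i)^2 has the parity of i + l + 1. *)
Lemma lattice_sumN (R : comNzRingType) (M i l : nat) (q : R) :
  lattice_sum M (- q) i l = (-1) ^+ (i + l).+1 * lattice_sum M q i l.
Proof.
rewrite mulr_sumr; apply: eq_bigr => n _; rewrite [LHS]exprNn; congr (_ * _).
rewrite -[LHS]signr_odd -[RHS]signr_odd; congr (_ ^+ (nat_of_bool _)).
rewrite /sqdist !oddD !oddX /=; case: (leqP i n) => ?; lia.
Qed.

(** Replacing n by n + 1 moves one unit from i to l; the term with n = 0 has no
    counterpart. *)
Lemma lattice_sum_shift (R : comNzRingType) (M i l : nat) (q : R) :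
  q ^+ M = 0 ->
  lattice_sum M q i.+1 l =
  q ^+ (l.+1 ^ 2 + i.+1 ^ 2) + lattice_sum M q i l.+1.
Proof.
case: M => [|M] qM.
  by rewrite -[LHS]mulr1 -[RHS]mulr1 -(expr0 q) qM !mulr0.
rewrite /lattice_sum [LHS]big_ord_recl [in RHS]big_ord_recr /=.
rewrite [X in _ = _ + (_ + X)](expr_nil qM) ?addr0; last by nia.
congr (_ + _); apply: eq_bigr => n _.
by rewrite /bump leq0n add1n sqdistSS addSnnS.
Qed.

(** The sum of q^((n+l+1)^2 + (n-i)^2) over all integers n: the substitution
    n -> -1-n identifies the negative n with the sum for (l, i). *)
Definition sym_lattice_sum (R : comNzRingType) (M : nat) (q : R)
    (i l : nat) : R :=
  lattice_sum M q i l + lattice_sum M q l i.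

(** Translation of n in the sum over Z.  On the two halves, the boundary term of
    [lattice_sum_shift] is symmetric in i and l and therefore cancels. *)
Lemma sym_lattice_sum_invariant (R : comNzRingType) (M i l : nat) (q : R) :
  q ^+ M = 0 -> sym_lattice_sum M q i l = sym_lattice_sum M q 0 (i + l).
Proof.
move=> qM; elim: i l => // i IHi l; rewrite addSnnS -IHi /sym_lattice_sum.
rewrite (lattice_sum_shift _ _ qM) (lattice_sum_shift l i qM).
by rewrite addnC; ring.
Qed.

(** (n+m+1)^2 + (n-m)^2 = 2n(n+1) + 2m(m+1) + 1. *)
Lemma lattice_sum_diag (R : comNzRingType) (M m : nat) (q : R) :
  lattice_sum M q m m =
  q ^+ (2 * (m * m.+1)).+1 * \sum_(n < M) (q ^+ 2) ^+ (n * n.+1).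
Proof.
rewrite mulr_sumr; apply: eq_bigr => n _.
rewrite -exprM -exprD; congr (_ ^+ _).
by rewrite /sqdist; case: (leqP m n) => ?; nia.
Qed.

Lemma antidiagonal_sum (R : nmodType) (L : nat) (F : nat -> nat -> R) :
  (forall i l, (L <= i + l)%N -> F i l = 0) ->
  \sum_(i < L) \sum_(l < L) F i l =
  \sum_(N < L) \sum_(l < N.+1) F (N - l)%N l.
Proof.
move=> F0; rewrite exchange_big /=.
rewrite [RHS](eq_bigr (fun N : 'I_L =>
  \sum_(l < L | (l <= N)%N) F (N - l)%N l)); last first.
  by move=> N _; rewrite (big_ord_widen_cond L predT (fun l => F (N - l)%N l)).
rewrite [RHS](exchange_big_dep predT) //=; apply: eq_bigr => l _.
transitivity (\sum_(0 <= i < L - l) F i l).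
  rewrite -(big_mkord xpredT (fun i => F i l)).
  rewrite (big_cat_nat (n := (L - l)%N)) ?leq_subr //=.
  rewrite [X in _ + X]big_nat_cond [X in _ + X]big1 ?addr0 // => i.
  by case/andP=> /andP[le_i _] _; apply: F0; lia.
rewrite -(big_mkord (fun N => (l <= N)%N) (fun N => F (N - l)%N l)).
rewrite [RHS](big_cat_nat (n := l)) //=; last exact: ltnW.
rewrite [X in _ = X + _]big_nat_cond [X in _ = X + _]big1 ?add0r; last first.
  by move=> i /andP[/andP[_ ?] ?]; lia.
transitivity (\sum_(0 + l <= N < L) F (N - l)%N l).
  by rewrite big_addn; apply: eq_bigr => i _; rewrite addnK.
rewrite add0n [LHS]big_nat_cond [RHS]big_nat_cond; apply: eq_bigl => i.
by case: (l <= i)%N; rewrite ?andbT ?andbF.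
Qed.

Lemma sum_double (R : nmodType) (K : nat) (F : nat -> R) :
  \sum_(N < 2 * K) F N = \sum_(m < K) (F (2 * m)%N + F (2 * m).+1).
Proof.
elim: K => [|K IHK]; first by rewrite !big_ord0.
by rewrite mulnS 2!big_ord_recr big_ord_recr /= IHK addrA.
Qed.

(** The sequences t and t' are the terms of v(q) and of v(-q).  Both sides carry
    an extra factor 2, because the symmetrization in (i, l) doubles the sum and
    R may have torsion; it is cancelled in Z at the very end. *)
Lemma mock_odd_part (R : comNzRingType) (M : nat) (q : R) (t t' : nat -> R) :
  q ^+ M = 0 ->
  (forall n, qpoch q (q ^+ 2) n.+1 * t n =
             q ^+ (n.+1 ^ 2) * qpoch (- q) (q ^+ 2) n) ->
  (forall n, qpoch (- q) (q ^+ 2) n.+1 * t' n =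
             (- q) ^+ (n.+1 ^ 2) * qpoch q (q ^+ 2) n) ->
  2 * (qpoch q (q ^+ 2) (2 * M) * qpoch (- q) (q ^+ 2) (2 * M) *
       (\sum_(n < M) t n - \sum_(n < M) t' n)) =
  4 * (q * (\sum_(k < M) (q ^+ 2) ^+ (k * k.+1)) *
       qpoch (- (q ^+ 2) ^+ 2) ((q ^+ 2) ^+ 2) M).
Proof.
move=> qM def_t def_t'; set p := q ^+ 2; pose U := qfact_inv M p.
have pM : p ^+ M = 0 by exact: exprX_nil.
pose L := (2 * M.+1)%N.
have expand y s : y ^+ M = 0 -> y ^+ 2 = p ->
    (forall n, qpoch y (y ^+ 2) n.+1 * s n =
               y ^+ (n.+1 ^ 2) * qpoch (- y) (y ^+ 2) n) ->
    qpoch y p (2 * M) * qpoch (- y) p (2 * M) * (\sum_(n < M) s n) =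
    \sum_(i < L) \sum_(l < L) (-1) ^+ l * (U i * U l) * lattice_sum M y i l.
  move=> yM y2 def_s.
  rewrite [qpoch (- y) p _](qpoch_stable (n := M) _ pM) //; last by lia.
  rewrite mulr_sumr.
  rewrite (eq_bigr (fun n : 'I_M => \sum_(i < L) \sum_(l < L)
    (-1) ^+ l * (U i * U l) * y ^+ ((n + l).+1 ^ 2 + sqdist n i))); last first.
    move=> n _; rewrite /U -y2; apply: mock_term_expansion => //.
    by rewrite /L; lia.
  rewrite exchange_big; apply: eq_bigr => i _; rewrite exchange_big.
  by apply: eq_bigr => l _; rewrite -mulr_sumr.
have qNM : (- q) ^+ M = 0 by rewrite exprNn qM mulr0.
have exp_q := expand q t qM (erefl p) def_t.
have := expand (- q) t' qNM (sqrrN q); rewrite sqrrN opprK.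
move=> /(_ def_t'); rewrite [qpoch (- q) _ _ * _]mulrC => exp_qN.
rewrite mulrBr exp_q exp_qN.
(* the sign (-1)^l counted in v(q) and, with the parity of the exponent, in
   -v(-q): zero unless i and l have the same parity *)
pose c i l : R := (-1) ^+ i + (-1) ^+ l.
pose S i l := c i l * (U i * U l) * lattice_sum M q i l.
transitivity (2 * \sum_(i < L) \sum_(l < L) S i l).
  congr (_ * _); rewrite -sumrB; apply: eq_bigr => i _; rewrite -sumrB.
  apply: eq_bigr => l _; rewrite lattice_sumN /S /c exprS exprD.
  have sq : (-1) ^+ l * (-1) ^+ l = 1 :> R by rewrite -expr2 sqrr_sign.
  transitivity (((-1) ^+ l + (-1) ^+ i * ((-1) ^+ l * (-1) ^+ l)) *
                (U i * U l) * lattice_sum M q i l).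
    by ring.
  by rewrite sq; ring.
transitivity (\sum_(i < L) \sum_(l < L)
    c i l * (U i * U l) * sym_lattice_sum M q 0 (i + l)).
  rewrite mulr2n mulrDl mul1r {2}exchange_big /= -big_split.
  apply: eq_bigr => i _.
  rewrite -big_split; apply: eq_bigr => l _ /=.
  rewrite -(sym_lattice_sum_invariant _ _ qM) /S /c /sym_lattice_sum; ring.
rewrite (antidiagonal_sum (F := fun i l =>
  c i l * (U i * U l) * sym_lattice_sum M q 0 (i + l))); last first.
  move=> i l le_L; rewrite /sym_lattice_sum !lattice_sum_large ?addr0 ?mulr0 //.
    by rewrite /L in le_L; lia.
  by rewrite /L in le_L; lia.
rewrite /L (sum_double M.+1 (fun N => \sum_(l < N.+1)
  c (N - l)%N l * (U (N - l)%N * U l) * sym_lattice_sum M q 0 (N - l + l))).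
(* odd antidiagonals carry c = 0, the others are Gauss sums *)
transitivity (\sum_(m < M.+1)
  4 * lattice_sum M q m m * qfact_inv M (p ^+ 2) m).
  apply: eq_bigr => m _; rewrite [X in _ + X]big1 ?addr0; last first.
    move=> l _; have le_l := leq_ord l.
    rewrite /c -signr_odd -[X in _ + X]signr_odd oddB //.
    rewrite oddS oddM /=.
    by case: (odd l); rewrite ?(addrN, addNr, subrr) ?mul0r.
  rewrite -(gauss_alternating m pM) mulr_sumr; apply: eq_bigr => l _.
  case: l => l /=; rewrite ltnS => le_l.
  have m2 : sym_lattice_sum M q 0 (2 * m) = 2 * lattice_sum M q m m.
    rewrite mul2n -addnn -(sym_lattice_sum_invariant _ _ qM) /sym_lattice_sum.
    by rewrite mulr_natl mulr2n.
  rewrite /c subnK // m2 -[X in X + _ ]signr_odd oddB // oddM /= signr_odd /U.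
  by ring.
rewrite -(@euler_qexp _ M _ M.+1) //; last exact: exprX_nil.
rewrite mulr_sumr mulr_sumr; apply: eq_bigr => m _.
rewrite lattice_sum_diag -/p.
have -> : (p ^+ 2) ^+ m * (p ^+ 2) ^+ 'C(m, 2) = q ^+ (2 * (m * m.+1)).
  rewrite /p -!exprM -exprD; congr (_ ^+ _).
  by have := bin2_double m; nia.
rewrite exprS; ring.
Qed.

(** * Generating function of 4-regular partitions *)
Lemma qpochMN (R : comNzRingType) (b q : R) (n : nat) :
  qpoch b q n * qpoch (- b) q n = qpoch (b ^+ 2) (q ^+ 2) n.
Proof.
rewrite -big_split; apply: eq_bigr => i _ /=.
by rewrite -exprM mulnC exprM; ring.
Qed.

Lemma qpoch_dissect (R : comNzRingType) (p : R) (n : nat) :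
  qpoch p p (2 * n) = qpoch p (p ^+ 2) n * qpoch (p ^+ 2) (p ^+ 2) n.
Proof.
rewrite -big_split /= /qpoch; elim: n => [|n IHn]; first by rewrite !big_ord0.
rewrite mulnS 2!big_ord_recr big_ord_recr /= IHn -mulrA; congr (_ * _).
by rewrite -exprM -!exprS -exprD.
Qed.

Definition bounded_regular (l k n : nat) (s : seq nat) : bool :=
  is_regular_partition l n s && all (fun x => x <= k)%N s.

(** A duplicate-free enumeration, so that counting identities reduce to equality
    of membership up to permutation. *)
Definition bounded_regular_seqs (l k n : nat) : seq (seq nat) :=
  [seq map val s |
     s : n.-bseq 'I_n.+1 <-
       enum [set s : n.-bseq 'I_n.+1 | bounded_regular l k n (map val s)]].

Lemma bounded_regular_seqs_uniq (l k n : nat) :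
  uniq (bounded_regular_seqs l k n).
Proof.
rewrite map_inj_uniq ?enum_uniq // => s t /(inj_map val_inj) eq_st.
exact: val_inj.
Qed.

Lemma mem_bounded_regular_seqs (l k n : nat) (s : seq nat) :
  (s \in bounded_regular_seqs l k n) = bounded_regular l k n s.
Proof.
apply/mapP/idP => [[t]|]; first by rewrite mem_enum inE => ? ->.
move=> s_ok; have /andP[/andP[/partition_bound/andP[le_s lt_s] _] _] := s_ok.
have val_s : map val (pmap insub s : seq 'I_n.+1) = s.
  rewrite (pmap_filter (insubK _)); apply/all_filterP.
  by apply: sub_all lt_s => x lt_x /=; rewrite insubT.
have le_t : (size (pmap insub s : seq 'I_n.+1) <= n)%N.
  by rewrite -(size_map val) val_s.
by exists (Bseq le_t); rewrite ?mem_enum ?inE /= val_s.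
Qed.

Definition num_bounded_regular (l k n : nat) : nat :=
  size (bounded_regular_seqs l k n).

Lemma bounded_regular_cons (l k n x : nat) (s : seq nat) :
  bounded_regular l k n (x :: s) =
  [&& (0 < x <= n)%N, (x <= k)%N, ~~ (l %| x)%N &
      bounded_regular l x (n - x) s].
Proof.
rewrite /bounded_regular /is_regular_partition /is_partition /=.
rewrite path_sortedE; last by move=> a b c /= ab ca; exact: leq_trans ca ab.
rewrite inE negb_or eq_sym -lt0n.
have -> : (x + sumn s == n)%N = (x <= n)%N && (sumn s == n - x)%N.
  by apply/eqP/andP => [<-|[? /eqP ->]]; rewrite ?leq_addr ?addKn ?subnKC.
have [x_gt0|] := ltnP 0 x; last by rewrite ?andbF.
have [le_xn|] := leqP x n; last by rewrite /= ?andbF.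
have [le_xk|] := leqP x k; last by rewrite /= ?andbF.
have [all_s|] := boolP (all _ s); last by rewrite /= ?andbF.
rewrite !andbT /=; case: (l %| x)%N; rewrite ?andbF //=.
have -> : all (fun y => y <= k)%N s.
  by apply: sub_all all_s => y /= /leq_trans->.
by rewrite ?andbT.
Qed.

(** Either all parts are at most k, or the largest part is k + 1, which must
    then be allowed, and its removal leaves a partition with the same bound. *)
Lemma num_bounded_regularS (l k n : nat) :
  num_bounded_regular l k.+1 n =
  (num_bounded_regular l k n +
   if ~~ (l %| k.+1) && (k < n) then num_bounded_regular l k.+1 (n - k.+1)
   else 0)%N.
Proof.
pose new := if ~~ (l %| k.+1)%N && (k < n)%N
  then [seq k.+1 :: s | s <- bounded_regular_seqs l k.+1 (n - k.+1)] else [::].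
have -> : (if ~~ (l %| k.+1) && (k < n)
    then num_bounded_regular l k.+1 (n - k.+1) else 0)%N = size new.
  by rewrite /new; case: ifP => // _; rewrite (size_map (cons k.+1)).
rewrite -size_cat; apply/perm_size/uniq_perm.
- exact: bounded_regular_seqs_uniq.
- have inj_cons : injective (cons k.+1) by move=> s t [].
  rewrite cat_uniq bounded_regular_seqs_uniq /= andbC; apply/andP; split.
    rewrite /new; case: ifP => // _.
    by rewrite (map_inj_uniq inj_cons) bounded_regular_seqs_uniq.
  rewrite /new; case: ifP => // _; apply/hasPn => _ /mapP[s _ ->].
  by rewrite mem_bounded_regular_seqs bounded_regular_cons ltnn andbF.
move=> s; rewrite mem_cat !mem_bounded_regular_seqs.
case: s => [|x s].
  rewrite /new; case: ifP => _; last by rewrite orbF.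
  by rewrite (_ : (_ \in _) = false) ?orbF //; apply/negbTE/mapP => -[].
have -> : ((x :: s) \in new) = [&& x == k.+1, ~~ (l %| k.+1)%N, (k < n)%N &
    bounded_regular l k.+1 (n - k.+1) s].
  rewrite /new; case: (~~ _ && _) / andP => [[-> ->]|no] /=.
    apply/mapP/andP => [[t]|[/eqP-> ?]].
      by rewrite mem_bounded_regular_seqs => ? [-> ->].
    by exists s; rewrite ?mem_bounded_regular_seqs.
  by apply/esym/negP => /and4P[_ ? ? _]; case: no.
rewrite !bounded_regular_cons (leq_eqVlt x k.+1) ltnS.
case: eqVneq => [->|_] /=; last by rewrite orbF.
by rewrite ltnn andbF /= andbCA.
Qed.

Lemma num_bounded_regular0 (l n : nat) : num_bounded_regular l 0 n = (n == 0)%N.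
Proof.
transitivity (size (nseq (n == 0)%N ([::] : seq nat))).
  2: by rewrite size_nseq.
apply/perm_size/uniq_perm.
- exact: bounded_regular_seqs_uniq.
- by case: (n == 0)%N.
move=> s; rewrite mem_bounded_regular_seqs mem_nseq lt0b.
case: s => [|x s].
  rewrite eqxx andbT /bounded_regular /is_regular_partition /is_partition /=.
  by rewrite !andbT eq_sym.
rewrite bounded_regular_cons [RHS]andbF.
apply/negP => /and4P[/andP[x_gt0 _] le_x0 _ _].
by rewrite ltnNge le_x0 in x_gt0.
Qed.

Lemma num_regularE (l k n : nat) :
  (n <= k)%N -> num_regular l n = num_bounded_regular l k n.
Proof.
move=> le_nk; rewrite /num_bounded_regular size_map -cardE /num_regular.
apply: eq_card => s; rewrite !inE; apply/idP/andP => [reg_s|[]//]; split=> //.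
have /andP[/partition_bound/andP[_ lt_s] _] := reg_s.
by apply: sub_all lt_s => x /= lt_x; rewrite (leq_trans _ le_nk).
Qed.

(** Substitution of y in the series a, truncated at M: a ring morphism as soon
    as y^M = 0. *)
Definition fps_eval (R : comNzRingType) (M : nat) (a : fps) (y : R) : R :=
  \sum_(m < M) (a m)%:~R * y ^+ m.

Lemma fps_evalM (R : comNzRingType) (M : nat) (a b : fps) (y : R) :
  y ^+ M = 0 ->
  fps_eval M (fps_mul a b) y = fps_eval M a y * fps_eval M b y.
Proof.
move=> yM; rewrite [RHS]big_distrlr /=.
rewrite (@antidiagonal_sum R M (fun i l =>
  (a i)%:~R * y ^+ i * ((b l)%:~R * y ^+ l))); last first.
  by move=> i l le_M; rewrite mulrACA -exprD (expr_nil yM le_M) mulr0.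
apply: eq_bigr => n _.
rewrite rmorph_sum mulr_suml (reindex_inj rev_ord_inj) /=.
apply: eq_bigr => l _; rewrite subSS subKn ?leq_ord //.
by rewrite rmorphM /= mulrACA -exprD subnK ?leq_ord.
Qed.

Lemma fps_eval_shift (R : comNzRingType) (M d : nat) (a : fps) (y : R) :
  y ^+ M = 0 ->
  fps_eval M (fun n => if (d <= n)%N then a (n - d)%N else 0) y =
  y ^+ d * fps_eval M a y.
Proof.
move=> yM; elim: d => [|d IHd].
  by rewrite mul1r; apply: eq_bigr => n _; rewrite subn0.
rewrite exprS -mulrA -IHd; case: M yM {IHd} => [|M] yM.
  by rewrite /fps_eval !big_ord0 mulr0.
rewrite /fps_eval [LHS]big_ord_recl mul0r add0r [in RHS]big_ord_recr mulrDr /=.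
rewrite [X in _ = _ + X]mulrCA -exprS yM mulr0 addr0 mulr_sumr.
apply: eq_bigr => n _.
by rewrite /bump leq0n add1n ltnS subSS exprS mulrCA.
Qed.

(** By [num_bounded_regularS], admitting an allowed part k + 1 divides the
    generating function by 1 - y^(k+1). *)
Lemma bounded_regular_gf (R : comNzRingType) (l M k : nat) (y : R) :
  y ^+ M = 0 ->
  fps_eval M (fun n => (num_bounded_regular l k n)%:Z) y *
    (\prod_(j < k | ~~ (l %| j.+1)%N) (1 - y ^+ j.+1)) = 1.
Proof.
move=> yM; elim: k => [|k IHk].
  rewrite big_ord0 mulr1; case: M yM => [|M] yM.
    by rewrite /fps_eval big_ord0 -yM expr0.
  rewrite /fps_eval big_ord_recl num_bounded_regular0 mulr1.
  rewrite big1 ?addr0 // => i _.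
  by rewrite num_bounded_regular0 mul0r.
rewrite big_mkcond big_ord_recr -big_mkcond /= -[RHS]IHk mulrA mulrAC.
congr (_ * _).
pose c j n := (num_bounded_regular l j n)%:Z.
have [dvd_k|ndvd_k] := boolP (l %| k.+1)%N.
  rewrite mulr1; apply: eq_bigr => n _.
  by rewrite num_bounded_regularS dvd_k addn0.
rewrite mulrBr mulr1 [X in _ - X]mulrC -fps_eval_shift //.
rewrite -sumrB; apply: eq_bigr => n _.
rewrite num_bounded_regularS ndvd_k PoszD rmorphD /= mulrDl.
by case: (k < n)%N; rewrite ?addrK ?subr0 // mul0r subr0 addr0.
Qed.

Lemma qpoch_dissect4 (R : comNzRingType) (p : R) (K : nat) :
  (\prod_(j < 4 * K | ~~ (4 %| j.+1)%N) (1 - p ^+ j.+1)) *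
    qpoch (p ^+ 4) (p ^+ 4) K = qpoch p p (4 * K).
Proof.
rewrite big_mkcond /qpoch.
elim: K => [|K IHK]; first by rewrite !big_ord0 mulr1.
rewrite mulnS !addSn add0n 8!big_ord_recr big_ord_recr -IHK /=.
have -> : (4 %| (4 * K).+1 = false)%N by lia.
have -> : (4 %| (4 * K).+2 = false)%N by lia.
have -> : (4 %| (4 * K).+3 = false)%N by lia.
have -> : (4 %| (4 * K).+4)%N by lia.
rewrite /= -!exprS -exprM mulnS !addSn add0n; ring.
Qed.

(** After multiplication by (p^2; p^2)_oo both sides are (p^4; p^4)_oo, because
    (p; p^2)_oo (p^2; p^2)_oo = (p; p)_oo is (p^4; p^4)_oo times the product
    over the allowed parts, which is inverse to the generating function. *)
Lemma regular4_gf (R : comNzRingType) (M : nat) (p : R) :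
  p ^+ M = 0 ->
  fps_eval M (fun n => (num_regular 4 n)%:Z) p * qpoch p (p ^+ 2) (2 * M) =
  qpoch (- p ^+ 2) (p ^+ 2) M.
Proof.
move=> pM; have p2M : (p ^+ 2) ^+ M = 0 by exact: exprX_nil.
have p4M : (p ^+ 4) ^+ M = 0 by exact: exprX_nil.
have reg := @lreg_qpoch R _ (p ^+ 2) M (2 * M) p2M; apply: reg.
(* 4M factors of (p; p)_oo are 2M factors of each of (p; p^2)_oo and
   (p^2; p^2)_oo, and M blocks of four consecutive parts *)
rewrite mulrC -mulrA -qpoch_dissect mulnA -qpoch_dissect4 mulrA.
have -> : fps_eval M (fun n => (num_regular 4 n)%:Z) p =
          fps_eval M (fun n => (num_bounded_regular 4 (4 * M) n)%:Z) p.
  apply: eq_bigr => n _; rewrite (@num_regularE _ (4 * M)) //.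
  by have := ltn_ord n; lia.
rewrite bounded_regular_gf // mul1r.
rewrite [qpoch (- _) _ M](@qpoch_stable _ _ _ M M (2 * M)) //; last by lia.
by rewrite qpochMN -exprM (@qpoch_stable _ _ _ M M (2 * M)) //; lia.
Qed.

(** * From nilpotent elements back to coefficients *)
Lemma fps_eval_poly (R : comNzRingType) (M : nat) (P : {poly int}) (y : R) :
  y ^+ M = 0 -> fps_eval M (fps_of_poly P) y = (map_poly intr P).[y].
Proof.
move=> yM; rewrite (@horner_coef_wide _ (M + size P)); last first.
  by rewrite (leq_trans (size_poly _ _)) ?leq_addl.
rewrite big_split_ord /= [X in _ + X]big1 ?addr0; last first.
  by move=> i _; rewrite (expr_nil yM) ?mulr0 ?leq_addr.
by apply: eq_bigr => i _; rewrite coef_map.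
Qed.

Lemma fps_eval_inv (R : comNzRingType) (M : nat) (a : fps) (y : R) :
  y ^+ M = 0 -> a 0%N = 1 -> fps_eval M a y * fps_eval M (fps_inv a) y = 1.
Proof.
move=> yM a0; rewrite -fps_evalM //; case: M yM => [|M] yM.
  by rewrite /fps_eval big_ord0 -yM expr0.
rewrite /fps_eval big_ord_recl fps_mulV // mulr1 big1 ?addr0 // => i _.
by rewrite fps_mulV // mul0r.
Qed.

(** Take the class of the indeterminate in Z[X]/(X^M), whose powers below M are
    linearly independent. *)
Lemma fps_eval_inj (M : nat) (a b : fps) :
  (forall (R : comNzRingType) (y : R),
     y ^+ M = 0 -> fps_eval M a y = fps_eval M b y) ->
  forall m, (m < M)%N -> a m = b m.
Proof.
case: M => [//|M] eq_ab m lt_m.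
pose h : {poly int} := 'X^(M.+1).
have mk_h : mk_monic h = h.
  by rewrite /mk_monic size_polyXn monicXn.
pose x : {poly %/ h} := in_qpoly h 'X.
have xE : forall k, x ^+ k = in_qpoly h 'X^k by move=> k; rewrite rmorphXn.
have eval_x c : fps_eval M.+1 c x = in_qpoly h (\poly_(i < M.+1) c i).
  rewrite poly_def rmorph_sum; apply: eq_bigr => i _ /=.
  have c_int : (c i)%:P = (c i)%:~R :> {poly int}.
    by rewrite -[in LHS](intz (c i)) rmorph_int.
  by rewrite xE -mul_polyC rmorphM /= c_int rmorph_int.
have xM : x ^+ M.+1 = 0.
  by rewrite xE; apply/val_inj; rewrite /= mk_h Pdiv.RingMonic.rmodpp ?monicXn.
have := eq_ab _ x xM; rewrite !eval_x.
move=> /(congr1 (fun u : {poly %/ h} => (u : {poly int})`_m)).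
rewrite !in_qpoly_small ?mk_h ?size_polyXn ?ltnS ?size_poly //.
by rewrite !coef_poly lt_m.
Qed.

Lemma map_qpoch (R S : comNzRingType) (f : {rmorphism R -> S}) (b q : R)
    (n : nat) :
  f (qpoch b q n) = qpoch (f b) (f q) n.
Proof.
rewrite rmorph_prod; apply: eq_bigr => i _.
by rewrite rmorphB rmorph1 rmorphM rmorphXn.
Qed.

Lemma horner_qpoch (R : comNzRingType) (b q : {poly R}) (y : R) (n : nat) :
  (qpoch b q n).[y] = qpoch b.[y] q.[y] n.
Proof. exact: (map_qpoch (horner_eval y)). Qed.

Lemma fps_eval_v_term (R : comNzRingType) (M n : nat) (y : R) :
  y ^+ M = 0 ->
  qpoch y (y ^+ 2) n.+1 * fps_eval M (v_term n) y =
  y ^+ (n.+1 ^ 2) * qpoch (- y) (y ^+ 2) n.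
Proof.
move=> yM; have /(fps_eval_inv yM) := v_term_denom0 n.
rewrite fps_evalM // !fps_eval_poly // rmorphM /= map_polyXn !map_qpoch /=.
rewrite rmorphN /= !map_polyXn map_polyX.
rewrite hornerM !horner_qpoch hornerN hornerX !hornerXn.
by rewrite !addn1 => inv; rewrite mulrCA inv mulr1.
Qed.

Lemma fps_eval_v (R : comNzRingType) (M : nat) (Pv : fps) (y : R) :
  is_v Pv -> fps_eval M Pv y = \sum_(n < M) fps_eval M (v_term n) y.
Proof.
move=> HPv; rewrite exchange_big; apply: eq_bigr => m _ /=.
rewrite -mulr_suml -rmorph_sum; congr (_%:~R * _).
have [N0 HN0] := HPv m; rewrite -(HN0 (M + N0)%N) ?leq_addl //.
rewrite big_split_ord /= [X in _ + X]big1 ?addr0 // => i _.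
by apply: v_term_small; have := ltn_ord m; nia.
Qed.

Lemma A4_sub (n m : nat) :
  A4 (n%:Z - m%:Z) = (if (m <= n)%N then num_regular 4 (n - m) else 0)%N.
Proof.
case: leqP => [le_mn|lt_nm]; first by rewrite subzn.
rewrite -opprB subzn ?(ltnW lt_nm) //.
by have : (0 < m - n)%N by [rewrite subn_gt0]; case: (m - n)%N.
Qed.

Theorem theorem3p4 (Pv : nat -> int) (HPv : is_v Pv) (n : nat) :
  sums_to (fun k : nat => (A4 (n%:Z - (k * (k + 1))%N%:Z))%:Z)
          (Pv (2 * n + 1)%N).
Proof.
(* the coefficient of index 2n + 1 is the last one visible modulo q^M *)
pose M := (2 * n).+2.
(* twice v(q) - v(-q), and the product 4 q psi A(q^2) multiplied out *)
pose a : fps := fun m => 2 * (Pv m - (-1) ^+ m * Pv m).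
pose B : {poly int} := \sum_(k < M) \sum_(j < M)
  (4 * (num_regular 4 j)%:Z) *: 'X^((2 * (k * k.+1) + 2 * j).+1).
have aB : a (2 * n + 1)%N = B`_(2 * n + 1)%N.
  apply: (@fps_eval_inj M a (fps_of_poly B)); last by rewrite addn1.
  move=> R q qM; rewrite fps_eval_poly //.
  have qNM : (- q) ^+ M = 0 by rewrite exprNn qM mulr0.
  have pM : (q ^+ 2) ^+ M = 0 by exact: exprX_nil.
  have term n' := fps_eval_v_term n' qM.
  have termN n' := fps_eval_v_term n' qNM.
  rewrite !sqrrN opprK in termN.
  have odd_part := mock_odd_part qM term termN.
  rewrite -!(fps_eval_v _ _ HPv) in odd_part.
  have -> : fps_eval M a q = 2 * (fps_eval M Pv q - fps_eval M Pv (- q)).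
    rewrite -sumrB mulr_sumr; apply: eq_bigr => m _.
    by rewrite rmorphM rmorphB rmorphM rmorph_sign /= [(- q) ^+ m]exprNn; ring.
  have -> : (map_poly intr B).[q] =
      4 * (q * (\sum_(k < M) (q ^+ 2) ^+ (k * k.+1)) *
           fps_eval M (fun j => (num_regular 4 j)%:Z) (q ^+ 2)).
    rewrite rmorph_sum horner_sum [q * _]mulr_sumr big_distrlr /= mulr_sumr.
    apply: eq_bigr => k _; rewrite rmorph_sum horner_sum mulr_sumr.
    apply: eq_bigr => j _.
    rewrite /= map_polyZ map_polyXn hornerZ hornerXn rmorphM /=.
    by rewrite exprS exprD !exprM; ring.
  have reg := @lreg_qpoch R _ (q ^+ 2 ^+ 2) M (2 * M) pM; apply: reg.
  rewrite -qpochMN mulrCA odd_part.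
  by rewrite qpochMN -regular4_gf //; ring.
have coef_B : B`_(2 * n + 1) =
    4 * \sum_(k < M) (A4 (n%:Z - (k * (k + 1))%N%:Z))%:Z.
  rewrite /B coef_sum mulr_sumr; apply: eq_bigr => k _.
  rewrite coef_sum addn1 A4_sub addn1; case: leqP => [le_kn|lt_nk].
    have lt_j : (n - k * k.+1 < M)%N by rewrite /M; lia.
    rewrite (bigD1 (Ordinal lt_j)) //= coefZ coefXn.
    rewrite (_ : (_ == _)) ?mulr1; last by apply/eqP; lia.
    rewrite big1 ?addr0 // => j ne_j; rewrite coefZ coefXn.
    rewrite (_ : (_ == _) = false) ?mulr0 //; apply: contraNF ne_j => /eqP eq_j.
    by apply/eqP/val_inj => /=; lia.
  rewrite mulr0 big1 // => j _; rewrite coefZ coefXn.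
  by rewrite (_ : (_ == _) = false) ?mulr0 //; apply/eqP; lia.
exists M => N le_MN; rewrite -(subnKC le_MN) big_split_ord /=.
rewrite [X in _ + X]big1 ?addr0; last first.
  move=> k _; rewrite A4_sub ifN // -ltnNge; rewrite /M; nia.
move: aB; rewrite coef_B /a -signr_odd addn1 oddS oddM /= expr1.
by move=> eq4; apply: (@mulfI _ 4) => //; rewrite -eq4; ring.
Qed.
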